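(* Let $n\ge0$ and $j\ge0$ be integers. The number of partitions $\pi$ with $\mathcal{E}(\pi)=n$ and $\gamma(\pi)=j$ equals the number of 2-color partitions of $n$ (parts colored red or green) in which every red part is $\le j$.
   Context: A partition $\pi=(\lambda_1,\lambda_2,\dots)$ is a finite non-increasing sequence of positive integers; the empty sequence is the unique partition of $0$. $\mathcal{E}(\pi)=\lambda_2+\lambda_4+\cdots$ and $\gamma(\pi)=\lambda_1-\lambda_2+\lambda_3-\lambda_4+\cdots$. In a 2-color partition each part is colored red or green; partitions differing in coloring are distinct; green parts are unrestricted. *)

(* Defs.v *)
From HB Require Import structures.
From mathcomp Require Import all_boot all_order all_algebra finmap.
From mathcomp Require Import boolp classical_sets functions cardinality.

Set Implicit Arguments.
Unset Strict Implicit.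
Unset Printing Implicit Defensive.

Import Order.TTheory GRing.Theory Num.Theory.
Local Open Scope classical_set_scope.

Definition is_partition (p : seq nat) : bool := sorted geq p && (0 \notin p).

(* lambda_(i+1) is nth 0 p i, so the parts lambda_2, lambda_4, ... are those of
   odd position i. *)
Definition even_indexed_sum (p : seq nat) : nat :=
  \sum_(i < size p | odd i) nth 0 p i.

Definition alternating_sum (p : seq nat) : int :=
  (\sum_(i < size p) (-1) ^+ i * (nth 0%N p i)%:Z)%R.

Variant color := Red | Green.

Definition bool_of_color (c : color) : bool := if c is Red then true else false.
Definition color_of_bool (b : bool) : color := if b then Red else Green.

Lemma bool_of_colorK : cancel bool_of_color color_of_bool.
Proof. by case. Qed.

HB.instance Definition _ := Countable.copy color (can_type bool_of_colorK).

(* The converse of a total order: by size, and green below red at equal size.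
   A colored_geq-sorted sequence represents a multiset of colored parts
   in a unique way. *)
Definition colored_geq (x y : nat * color) : bool :=
  (y.1 < x.1) || ((y.1 == x.1) && ((y.2 == Red) ==> (x.2 == Red))).

Definition is_2color_partition (p : seq (nat * color)) : bool :=
  sorted colored_geq p && all (fun x => 0 < x.1) p.

Definition colored_weight (p : seq (nat * color)) : nat :=
  \sum_(x <- p) x.1.

Definition partitions_E_gamma (n j : nat) : set (seq nat) :=
  [set p | [/\ is_partition p, even_indexed_sum p = n
             & alternating_sum p = j%:Z%R]].

Definition red_bounded_2color_partitions (n j : nat) :
    set (seq (nat * color)) :=
  [set p | [/\ is_2color_partition p, colored_weight p = n
             & forall x, x \in p -> x.2 = Red -> x.1 <= j]].

(* Main.v *)
(** With [c i] the alternating sum of the parts of [p] from position [i] on, one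
    has [nth 0 p i = c i + c i.+1].  Under this change of variables [p] is
    non-increasing iff [c i.+2 <= c i] for all [i], the alternating sum of [p] is
    [c 0], and the sum of its even-indexed parts is [c 1 + c 2 + c 3 + ...].  The
    values [c 2, c 4, ...] thus form a partition with parts at most [c 0], taken
    as the red parts, and [c 1, c 3, ...] form an unrestricted partition, taken
    as the green parts. *)
Require Import Defs.
From mathcomp Require Import all_boot all_order all_algebra finmap.
From mathcomp Require Import boolp classical_sets functions cardinality.
From mathcomp Require Import zify.

Set Implicit Arguments.
Unset Strict Implicit.
Unset Printing Implicit Defensive.

Import Order.TTheory GRing.Theory Num.Theory.
Local Open Scope classical_set_scope.

(** * Partitions as non-increasing functions that eventually vanish *)

Lemma geq_transitive : transitive geq.
Proof. by move=> y x z /= yx zy; apply: leq_trans zy yx. Qed.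

Lemma nonincreasing (f : nat -> nat) :
  (forall i, f i.+1 <= f i) -> forall i k, i <= k -> f k <= f i.
Proof.
move=> fS i k; elim: k => [|k IHk]; first by case: i.
by rewrite leq_eqVlt => /predU1P[-> //|/IHk]; apply: leq_trans.
Qed.

Lemma partition_nth_leq p i : is_partition p -> nth 0 p i.+1 <= nth 0 p i.
Proof.
case/andP=> sp _; have [ge|lt] := leqP (size p) i.+1; first by rewrite nth_default.
exact: (sortedP 0 sp).
Qed.

(** As no entry is 0, the default value of [nth] marks the end of the sequence, so the lengths need
    not be compared. *)
Lemma partition_eq p q :
  0 \notin p -> 0 \notin q -> nth 0 p =1 nth 0 q -> p = q.
Proof.
elim: p q => [|a p IHp] [|b q] //=.
- by rewrite inE negb_or => _ /andP[/eqP b0 _] /(_ 0)/= /b0.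
- by rewrite inE negb_or => /andP[/eqP a0 _] _ /(_ 0)/= /esym/a0.
rewrite !inE !negb_or => /andP[_ p0] /andP[_ q0] e.
by rewrite (e 0 : a = b) (IHp q) // => i; apply: (e i.+1).
Qed.

Lemma sumn_nth (s : seq nat) m : size s <= m -> sumn s = \sum_(i < m) nth 0 s i.
Proof.
elim: s m => [|a s IHs] [|m] //=; first by rewrite big_ord0.
  by move=> _; rewrite big1 // => i _; rewrite nth_nil.
by move=> le; rewrite big_ord_recl /= (IHs m).
Qed.

Definition trim (f : nat -> nat) (m : nat) : seq nat :=
  [seq x <- mkseq f m | 0 < x].

Lemma trim_partition (f : nat -> nat) m :
  (forall i, f i.+1 <= f i) -> is_partition (trim f m).
Proof.
move=> fS; rewrite /is_partition mem_filter /= andbT sorted_filter //.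
  exact: geq_transitive.
apply/(sortedP 0) => i; rewrite size_mkseq => lt.
by rewrite !nth_mkseq //= ?fS // ltnW.
Qed.

(** The zeros of a non-increasing [f] form a tail, so filtering them out shifts no index, and beyond
    the end the default 0 agrees with [f]. *)
Lemma nth_trim (f : nat -> nat) m i :
  (forall i, f i.+1 <= f i) -> f m = 0 -> nth 0 (trim f m) i = f i.
Proof.
have f0 g : (forall i, g i.+1 <= g i) -> g 0 = 0 -> forall i, g i = 0.
  by move=> gS g0 k; apply/eqP; rewrite -leqn0 -g0 nonincreasing.
elim: m f i => [|m IHm] f i fS fm; first by rewrite /trim nth_nil f0.
have eS k : nth 0 (trim (f \o S) m) k = f k.+1 by apply: IHm => //= l.
rewrite /trim /mkseq /= (iotaDl 1 0) -map_comp -/(mkseq (f \o S) m).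
have [f0gt|] := ltnP 0 (f 0); last rewrite leqn0 => /eqP f00.
  by case: i => //= i; apply: eS.
(* Here the head was filtered out, which does shift the indices, but [f] is 0 everywhere. *)
by rewrite [LHS]eS !(f0 f fS f00).
Qed.

(** * The two statistics in terms of [c] *)

Lemma even_indexed_sumE p m : size p <= m ->
  even_indexed_sum p = \sum_(k < m) nth 0 p k.*2.+1.
Proof.
move=> le; rewrite /even_indexed_sum.
have le2 : size p <= m.*2 by apply: leq_trans le _; rewrite -addnn leq_addr.
rewrite (big_ord_widen_cond _ (fun i => odd i) (nth 0 p) le2).
(* Padding with zeros up to an even bound lets each step of the induction on [m] add one even and
   one odd index. *)
transitivity (\sum_(i < m.*2 | odd i) nth 0 p i).
  rewrite big_mkcondr; apply: eq_bigr => i _; case: ltnP => // ge.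
  by rewrite nth_default.
elim: m {le le2} => [|m IHm]; first by rewrite !big_ord0.
rewrite doubleS !(big_mkcond (fun i : 'I__ => odd i)) !big_ord_recr /=.
by rewrite -big_mkcond /= IHm odd_double addn0.
Qed.

(** The sum telescopes. No boundary term remains: past the end of [p] the hypothesis reads
    [0 = c i + c i.+1] in [nat], which forces [c i = 0]. *)
Lemma alternating_sumE p (c : nat -> nat) :
  (forall i, nth 0 p i = c i + c i.+1) -> alternating_sum p = (c 0)%:Z%R.
Proof.
rewrite /alternating_sum; elim: p c => [|a p IHp] c e.
  by rewrite big_ord0; move: (e 0) => /=; case: (c 0).
rewrite /= big_ord_recl /= expr0 mul1r (e 0 : a = _).
have -> : (\sum_(i < size p) (-1) ^+ bump 0 i * (nth 0%N p i)%:Z =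
           - \sum_(i < size p) (-1) ^+ i * (nth 0%N p i)%:Z)%R.
  by rewrite -sumrN; apply: eq_bigr => i _; rewrite exprS mulN1r mulNr.
by rewrite (IHp (c \o S)) ?PoszD ?addrK // => i; apply: (e i.+1).
Qed.

(** The alternating sum with values in [nat]; on a non-increasing sequence the subtraction never
    truncates, by [alt_leq]. *)
Fixpoint alt (p : seq nat) : nat := if p is a :: t then a - alt t else 0.

Lemma alt_leq a p : path geq a p -> alt p <= a.
Proof. by case: p => [|b p] //= /andP[ba _]; apply: leq_trans (leq_subr _ _) ba. Qed.

Lemma nth_alt p i : sorted geq p ->
  nth 0 p i = alt (drop i p) + alt (drop i.+1 p).
Proof.
elim: p i => [|a p IHp] [|i] //= pp; last by rewrite IHp ?(path_sorted pp).
by rewrite drop0 subnK ?alt_leq.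
Qed.

(** * Splitting a 2-color partition into its red and green parts *)

Definition is_red (x : nat * color) : bool := x.2 == Red.
Definition reds (q : seq (nat * color)) := [seq x.1 | x <- q & is_red x].
Definition greens (q : seq (nat * color)) := [seq x.1 | x <- q & ~~ is_red x].

(** Once the colors are case-split, this form is within reach of [lia]. *)
Lemma colored_geqE x y : colored_geq x y =
  (y.1 < x.1) || ((y.1 == x.1) && (bool_of_color y.2 ==> bool_of_color x.2)).
Proof. by case: x y => [a []] [b []]. Qed.

Lemma colored_geq_trans : transitive colored_geq.
Proof. by move=> [y []] [x []] [z []]; rewrite ?colored_geqE /=; lia. Qed.

Lemma colored_geq_total : total colored_geq.
Proof. by move=> [y []] [x []]; rewrite ?colored_geqE /=; lia. Qed.

Lemma colored_geq_anti : antisymmetric colored_geq.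
Proof.
by move=> [y []] [x []]; rewrite ?colored_geqE /= => h;
  try (by congr pair; lia); lia.
Qed.

Lemma colored_partition_part q (P : pred (nat * color)) :
  is_2color_partition q -> is_partition [seq x.1 | x <- q & P x].
Proof.
case/andP=> sq /allP q0; apply/andP; split; last first.
  by apply/mapP=> -[x]; rewrite mem_filter => /andP[_ /q0]; case: x.1.
rewrite sorted_map; apply: (@sub_sorted _ colored_geq).
  by move=> x y; rewrite ?colored_geqE /=; lia.
exact: sorted_filter colored_geq_trans _ _ sq.
Qed.

(** The red and green parts determine the multiset of colored parts, and a sequence sorted for an
    antisymmetric order is determined by its multiset. *)
Lemma colored_partition_eq q1 q2 :
  is_2color_partition q1 -> is_2color_partition q2 ->
  reds q1 = reds q2 -> greens q1 = greens q2 -> q1 = q2.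
Proof.
move=> /andP[s1 _] /andP[s2 _] er eg.
apply: (sorted_eq colored_geq_trans colored_geq_anti) => //.
rewrite -(perm_filterC is_red q1) perm_sym -(perm_filterC is_red q2) perm_sym.
apply/permP => P; congr count.
have gE q : filter (predC is_red) q = [seq (k, Green) | k <- greens q].
  by elim: q => // -[k []] q IHq; [exact: IHq|exact (congr1 (cons (k, Green)) IHq)].
have rE q : filter is_red q = [seq (k, Red) | k <- reds q].
  by elim: q => // -[k []] q IHq; [exact (congr1 (cons (k, Red)) IHq)|exact: IHq].
by rewrite !gE !rE er eg.
Qed.

Lemma colored_weightE q : colored_weight q = sumn (reds q) + sumn (greens q).
Proof.
rewrite /colored_weight !sumnE !big_map !big_filter.
by rewrite (bigID is_red).
Qed.

Definition merge_colors (r s : seq nat) : seq (nat * color) :=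
  sort colored_geq ([seq (k, Red) | k <- r] ++ [seq (k, Green) | k <- s]).

Section MergeColors.

Variables r s : seq nat.
Hypotheses (pr : is_partition r) (ps : is_partition s).

Lemma merge_colors_partition : is_2color_partition (merge_colors r s).
Proof.
rewrite /is_2color_partition sort_sorted; last exact: colored_geq_total.
rewrite all_sort all_cat !all_map /=.
by apply/andP; split; apply/allP => -[|k] //= k0;
  move: pr ps => /andP[_] + /andP[_]; rewrite k0.
Qed.

Let sort_color c t : is_partition t ->
  sort colored_geq [seq (k, c) | k <- t] = [seq (k, c) | k <- t].
Proof.
case/andP=> st _; apply: sorted_sort; first exact: colored_geq_trans.
rewrite sorted_map; apply: sub_sorted st => x y /=.
by rewrite ?colored_geqE /= implybb andbT; lia.
Qed.

Lemma reds_merge_colors : reds (merge_colors r s) = r.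
Proof.
(* Filtering commutes with sorting, and what remains to be sorted has one color and is already in
   order. *)
rewrite /reds /merge_colors filter_sort; first last.
- exact: colored_geq_trans.
- exact: colored_geq_total.
rewrite filter_cat !filter_map (eq_filter (a2 := predT)) // filter_predT.
rewrite (eq_filter (a2 := pred0)) // filter_pred0 cats0 sort_color //.
by rewrite -map_comp map_id.
Qed.

Lemma greens_merge_colors : greens (merge_colors r s) = s.
Proof.
rewrite /greens /merge_colors filter_sort; first last.
- exact: colored_geq_trans.
- exact: colored_geq_total.
rewrite filter_cat !filter_map (eq_filter (a2 := pred0)) // filter_pred0 /=.
rewrite (eq_filter (a2 := predT)) // filter_predT sort_color //.
by rewrite -map_comp map_id.
Qed.

End MergeColors.

(** * From 2-color partitions to partitions *)

(** The sequence [c] read off from [q]; putting [j] in front of the red parts supplies [c 0]. *)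
Definition interleaved (j : nat) (q : seq (nat * color)) (i : nat) : nat :=
  nth 0 (if odd i then greens q else j :: reds q) i./2.

Definition red_bounded (j : nat) (q : seq (nat * color)) :=
  forall x, x \in q -> x.2 = Red -> x.1 <= j.

Lemma red_boundedP j q : red_bounded j q <-> forall k, k \in reds q -> k <= j.
Proof.
split=> [qj k /mapP[x]|rj x xq xr].
  by rewrite mem_filter => /andP[/eqP xr xq] ->; apply: qj.
by apply/rj/map_f; rewrite mem_filter xq /is_red xr eqxx.
Qed.

Lemma size_colors q : (size (reds q) <= size q) && (size (greens q) <= size q).
Proof. by rewrite !size_map !size_filter !count_size. Qed.

Lemma interleaved_eq0 j q i : (size q).*2 < i -> interleaved j q i = 0.
Proof.
move=> lt; have /andP[ler leg] := size_colors q.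
by rewrite /interleaved; case: ifP => oi; rewrite nth_default //=; lia.
Qed.

(** The cut-off is the first index from which [interleaved_eq0] guarantees that both summands
    vanish. *)
Definition colored_to_partition (j : nat) (q : seq (nat * color)) : seq nat :=
  trim (fun i => interleaved j q i + interleaved j q i.+1) (size q).*2.+1.

Section ColoredToPartition.

Variables (j : nat) (q : seq (nat * color)).
Hypotheses (pq : is_2color_partition q) (qj : red_bounded j q).

Lemma interleaved_mono i : interleaved j q i.+2 <= interleaved j q i.
Proof.
rewrite /interleaved /= negbK; case: ifP => _.
  exact/partition_nth_leq/colored_partition_part.
case: i./2 => [|k] /=; last exact/partition_nth_leq/colored_partition_part.
(* The case [c 2 <= c 0] compares the largest red part with [j]; this is where the bound on the red
   parts enters. *)
case: (ltnP 0 (size (reds q))) => [lt|]; last by move/(nth_default 0)->.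
by move/red_boundedP: qj; apply; apply: mem_nth.
Qed.

Let parts_mono i : interleaved j q i.+1 + interleaved j q i.+2 <=
  interleaved j q i + interleaved j q i.+1.
Proof. by rewrite addnC leq_add2r interleaved_mono. Qed.

Lemma colored_to_partition_partition : is_partition (colored_to_partition j q).
Proof. exact: trim_partition. Qed.

Lemma nth_colored_to_partition i :
  nth 0 (colored_to_partition j q) i = interleaved j q i + interleaved j q i.+1.
Proof. by rewrite nth_trim // !interleaved_eq0 //; lia. Qed.

Lemma alternating_sum_colored_to_partition :
  alternating_sum (colored_to_partition j q) = j%:Z%R.
Proof. exact: alternating_sumE nth_colored_to_partition. Qed.

Lemma even_indexed_sum_colored_to_partition :
  even_indexed_sum (colored_to_partition j q) = colored_weight q.
Proof.
have /andP[ler leg] := size_colors q.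
pose m := (size q).*2.+1.
rewrite (@even_indexed_sumE _ m); last first.
  by rewrite size_filter (leq_trans (count_size _ _)) // size_mkseq.
rewrite colored_weightE (@sumn_nth (reds q) m) ?(@sumn_nth (greens q) m);
  [|rewrite /m; lia..].
(* The term of index [k] is [c k.*2.+1 + c k.*2.+2], the green part plus the red part of index
   [k]. *)
rewrite addnC -big_split; apply: eq_bigr => k _ /=.
rewrite nth_colored_to_partition /interleaved /= odd_double /=.
by rewrite uphalf_double doubleK.
Qed.

End ColoredToPartition.

(* Both sequences [c] vanish far out, so they are recovered from the sums
   [c i + c i.+1] by descending induction. *)
Lemma interleaved_inj j q1 q2 :
  (forall i, interleaved j q1 i + interleaved j q1 i.+1 =
             interleaved j q2 i + interleaved j q2 i.+1) ->
  interleaved j q1 =1 interleaved j q2.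
Proof.
move=> e i; pose m := ((size q1).*2 + (size q2).*2).+1.
have [d] : exists d, m <= i + d by exists m; apply: leq_addl.
elim: d i => [|d IHd] i.
  by rewrite addn0 /m => le; rewrite !interleaved_eq0 //; lia.
by rewrite addnS -addSn => /IHd eS; move: (e i); rewrite eS => /addIn.
Qed.

(** * Bijectivity *)

Lemma colored_to_partition_inj j q1 q2 :
  is_2color_partition q1 -> is_2color_partition q2 ->
  red_bounded j q1 -> red_bounded j q2 ->
  colored_to_partition j q1 = colored_to_partition j q2 -> q1 = q2.
Proof.
move=> p1 p2 b1 b2 e.
have ec : interleaved j q1 =1 interleaved j q2.
  by apply: interleaved_inj => i; rewrite -!nth_colored_to_partition // e.
have z q P : is_2color_partition q -> 0 \notin [seq x.1 | x <- q & P x].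
  by move=> /(colored_partition_part P)/andP[].
apply: colored_partition_eq => //; apply: partition_eq; rewrite ?z // => k.
  (* The red parts start at index 2, since index 0 holds [j]. *)
  by move: (ec k.+1.*2); rewrite /interleaved odd_double doubleK.
by move: (ec k.*2.+1); rewrite /interleaved /= odd_double /= uphalf_double.
Qed.

(** The preimage merges the values of [c] at positive even indices, as red parts, with those at odd
    indices, as green parts, where [c i] is the alternating sum of the tail [drop i p]. *)
Lemma colored_to_partition_surj j p :
  is_partition p -> alternating_sum p = j%:Z%R ->
  exists q, [/\ is_2color_partition q, red_bounded j q
              & colored_to_partition j q = p].
Proof.
move=> pp altp; pose c i := alt (drop i p).
have pE i : nth 0 p i = c i + c i.+1 by apply: nth_alt; case/andP: pp.
have c0 : c 0 = j by move: altp; rewrite (alternating_sumE pE) => -[].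
have cSS i : c i.+2 <= c i.
  (* Two consecutive parts of [p] share the summand [c i.+1], which cancels. *)
  by have := partition_nth_leq i pp; rewrite !pE addnC leq_add2r.
have cm i : size p <= i -> c i = 0 by move=> le; rewrite /c drop_oversize.
have r_le i : c i.+1.*2.+2 <= c i.+1.*2 by apply: cSS.
have s_le i : c i.+1.*2.+1 <= c i.*2.+1 by apply: cSS.
pose r := trim (fun k => c k.+1.*2) (size p).
pose s := trim (fun k => c k.*2.+1) (size p).
have pr : is_partition r by apply: trim_partition.
have ps : is_partition s by apply: trim_partition.
pose q := merge_colors r s.
have qE : interleaved j q =1 c.
  move=> i; rewrite /interleaved reds_merge_colors // greens_merge_colors //.
  rewrite -{3}(odd_double_half i); case: (odd i); rewrite ?add0n ?add1n.
    by rewrite nth_trim // cm //; lia.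
  by case: i./2 => [|k] /=; rewrite ?c0 // nth_trim // cm //; lia.
have pq : is_2color_partition q by apply: merge_colors_partition.
have bq : red_bounded j q.
  apply/red_boundedP => k; rewrite reds_merge_colors // mem_filter.
  case/andP=> _ /mapP[i _ ->]; rewrite -c0.
  by apply: (@nonincreasing (fun i => c i.*2) _ 0 i.+1) => // l; apply: cSS.
exists q; split=> //; apply: partition_eq.
- by case/andP: (colored_to_partition_partition pq bq).
- by case/andP: pp.
by move=> i; rewrite nth_colored_to_partition // !qE.
Qed.

(** * Finiteness and equality of cardinalities *)

Lemma finite_bounded_seqs (T : Type) (A : set T) m : finite_set A ->
  finite_set [set s : seq T | size s <= m /\ forall i x0, i < size s -> A (nth x0 s i)].
Proof.
move=> fA; elim: m => [|m IHm].
  by apply: (sub_finite_set (B := [set [::]])) => // -[|x s] //= [].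
apply: sub_finite_set (_ : finite_set ([set [::]] `|`
   [set xs.1 :: xs.2 | xs in A `*` _])); last first.
  by rewrite finite_setU; split=> //; apply/finite_image/finite_setX/IHm.
move=> [|x s] /= [le sA]; [by left|right].
exists (x, s) => //=; split; first exact: (sA 0 x).
by split=> // i x0 lt; apply: (sA i.+1 x0).
Qed.

(** Positive parts of total [n] number at most [n], and each is at most [n]. *)
Lemma finite_red_bounded n j : finite_set (red_bounded_2color_partitions n j).
Proof.
pose A := `I_n.+1 `*` [set: color].
have fA : finite_set A.
  apply: finite_setX; first exact: finite_II.
  apply: (sub_finite_set (B := [set Red; Green])); last exact: finite_set2.
  by move=> [] _; [left|right].
apply: sub_finite_set (finite_bounded_seqs n fA) => q [/andP[_ q0] wq _].
split=> [|i x0 lt].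
  rewrite -wq /colored_weight; elim: q q0 {wq} => //= x q IHq /andP[x0 /IHq].
  by rewrite big_cons; lia.
split=> //=; rewrite ltnS -wq /colored_weight.
by rewrite (big_rem _ (mem_nth x0 lt)) leq_addr.
Qed.

Lemma partitions_E_gamma_image n j :
  partitions_E_gamma n j =
  colored_to_partition j @` red_bounded_2color_partitions n j.
Proof.
apply/seteqP; split=> [p [pp Ep altp]|_ [q [pq wq bq] <-]].
  have [q [pq bq qp]] := colored_to_partition_surj pp altp.
  exists q => //; split=> //.
  by rewrite -(even_indexed_sum_colored_to_partition pq bq) qp.
split; first exact: colored_to_partition_partition.
- by rewrite even_indexed_sum_colored_to_partition.
- exact: alternating_sum_colored_to_partition.
Qed.

Theorem theorem5p5 (n j : nat) :
  [/\ finite_set (partitions_E_gamma n j),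
      finite_set (red_bounded_2color_partitions n j)
    & #|` fset_set (partitions_E_gamma n j)|%fset =
      #|` fset_set (red_bounded_2color_partitions n j)|%fset ].
Proof.
(* Finiteness passes to the image, and injectivity on the finite source gives equal
   cardinalities. *)
have fin := finite_red_bounded n j; rewrite partitions_E_gamma_image; split=> //.
  exact: finite_image.
rewrite fset_set_image // card_in_imfset //= => q1 q2.
rewrite !in_fset_set // !inE => -[p1 _ b1] [p2 _ b2].
exact: colored_to_partition_inj.
Qed.
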